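(* Let $d>2$ be an even integer, let $t_1,t_2,t_3\in\mathbb{P}^1$ be distinct points, and let $C_1,C_2,C_3$ be conjugacy classes in $GL(r)=GL(r,\mathbb{C})$. If the relative character variety $\mathscr{X}^{\mathrm{irred}}(r,C_1,C_2,C_3)$ on $\mathbb{P}^1\setminus\{t_1,t_2,t_3\}$ is MC-minimal and has dimension $d$, then $r\le 3d$.
   Context: For conjugacy classes $C_1,C_2,C_3$ in $GL(r,\mathbb{C})$, the relative character variety is $$\mathscr{X}^{\mathrm{irred}}(r,C_1,C_2,C_3)=\{\rho:\pi_1(\mathbb{P}^1\setminus\{t_1,t_2,t_3\})\to GL(r,\mathbb{C})\ :\ \rho \text{ irreducible},\ \rho(\gamma_i)\in C_i\}/GL(r,\mathbb{C}),$$ where $\gamma_i$ is the loop around $t_i$ and $GL(r,\mathbb{C})$ acts by simultaneous conjugation. When it is non-empty its dimension is $\sum_{i=1}^3\dim C_i-2r^2+2$. To each $C_i$ one associates a partition $\lambda_i^0\ge\lambda_i^1\ge\dots\ge\lambda_i^{s_i}$ of $r$: if $C_i$ is semisimple, these are the multiplicities of the distinct eigenvalues; in general, they are the numbers, taken over all eigenvalues $a$ and all $j\ge1$, of Jordan blocks of size $\ge j$ with eigenvalue $a$ (i.e. for each eigenvalue the parts of the partition dual to its Jordan block partition), all collected in decreasing order. The defect is $\delta(C_1,C_2,C_3)=r-\lambda_1^0-\lambda_2^0-\lambda_3^0$. The relative character variety is called MC-minimal if $\delta(C_1,C_2,C_3)\ge 0$. *)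

(* Defs.v *)
From HB Require Import structures.
From mathcomp Require Import all_boot all_order all_algebra.
From mathcomp Require Import complex.
From mathcomp Require Import all_classical all_reals all_analysis.

Set Implicit Arguments.
Unset Strict Implicit.
Unset Printing Implicit Defensive.

Import Order.TTheory GRing.Theory Num.Theory.
Import numFieldNormedType.Exports.

Local Open Scope classical_set_scope.
Local Open Scope ring_scope.
Local Open Scope complex_scope.

(* The complex numbers are R[i] for R : realType. The coercion to numFieldType
   is what provides the Euclidean topology on R[i]. *)
Definition P1 (R : realType) : topologicalType :=
  one_point_compactification (R[i] : numFieldType).

Section FundamentalGroup.
Variable R : realType.
Local Notation I := (`[0, 1]%classic : set R).

(* Paths and homotopies are total functions of which only the values on [0, 1],
   resp. on [0, 1] x [0, 1], matter. *)

Definition is_loop (X : set (P1 R)) (b : P1 R) (f : R -> P1 R) : Prop :=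
  [/\ {within I, continuous f}, f @` I `<=` X, f 0 = b & f 1 = b].

Definition loop_concat (f g : R -> P1 R) : R -> P1 R :=
  fun s => if s <= 2^-1 then f (2 * s) else g (2 * s - 1).

Definition is_homotopy (X : set (P1 R)) (f g : R -> P1 R)
    (H : R * R -> P1 R) : Prop :=
  [/\ {within I `*` I, continuous H}, H @` (I `*` I) `<=` X,
      forall s, I s -> H (0, s) = f s & forall s, I s -> H (1, s) = g s].

Definition loop_homotopic (X : set (P1 R)) (b : P1 R) (f g : R -> P1 R) : Prop :=
  exists2 H, is_homotopy X f g H &
    forall u, I u -> H (u, 0) = b /\ H (u, 1) = b.

Definition freely_homotopic (X : set (P1 R)) (f g : R -> P1 R) : Prop :=
  exists2 H, is_homotopy X f g H & forall u, I u -> H (u, 0) = H (u, 1).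

(* Counterclockwise circle of radius e around x in the local coordinate z - x,
   or 1 / z when x is the point at infinity None. *)
Definition circle (x : P1 R) (e : R) : R -> P1 R := fun s =>
  let c := cos (2 * pi * s) in let d := sin (2 * pi * s) in
  match (x : option R[i]) with
  | Some z => Some (z + (e * c) +i* (e * d))
  | None => Some ((e^-1 * c) -i* (e^-1 * d))
  end.

Definition punctured (t : 'I_3 -> P1 R) : set (P1 R) := ~` range t.

(* A loop based at b which is a "loop around t i". As the elements of pi_1 in a
   free homotopy class form one conjugacy class, these are exactly the loops
   conjugate to a given choice of gamma_i. *)
Definition loop_around (t : 'I_3 -> P1 R) (b : P1 R) (i : 'I_3)
    (f : R -> P1 R) : Prop :=
  is_loop (punctured t) b f /\
  \forall e \near 0^'+, freely_homotopic (punctured t) f (circle (t i) e).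

End FundamentalGroup.

Section CharacterVariety.
Variables (R : realType) (r : nat).
Local Notation Mat := 'M[R[i]]_r.

Definition conj_orbit (g : Mat) : set Mat :=
  [set h | exists2 p : Mat, p \in unitmx & h = p *m g *m invmx p].

Definition conjugacy_class (C : set Mat) : Prop :=
  exists2 g, g \in unitmx & C = conj_orbit g.

(* A homomorphism from pi_1(X, b) to GL_r, as a homotopy invariant and
   multiplicative function on loops; its values on functions that are not loops
   are irrelevant. *)
Definition is_rep (X : set (P1 R)) (b : P1 R) (rho : (R -> P1 R) -> Mat) : Prop :=
  [/\ forall f, is_loop X b f -> rho f \in unitmx,
      forall f g, is_loop X b f -> is_loop X b g ->
        loop_homotopic X b f g -> rho f = rho g &
      forall f g, is_loop X b f -> is_loop X b g ->
        rho (loop_concat f g) = rho f *m rho g].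

(* Subspaces are row spaces of matrices. *)
Definition irreducible_rep (X : set (P1 R)) (b : P1 R)
    (rho : (R -> P1 R) -> Mat) : Prop :=
  (0 < r)%N /\
  forall U : Mat, (forall f, is_loop X b f -> stablemx U (rho f)) ->
    \rank U = 0%N \/ \rank U = r.

Definition irreps (t : 'I_3 -> P1 R) (b : P1 R) (C : 'I_3 -> set Mat) :
    set ((R -> P1 R) -> Mat) :=
  [set rho | [/\ is_rep (punctured t) b rho,
                 irreducible_rep (punctured t) b rho &
                 forall i f, loop_around t b i f -> C i (rho f)]].

Definition rep_equiv (X : set (P1 R)) (b : P1 R)
    (rho rho' : (R -> P1 R) -> Mat) : Prop :=
  exists2 p : Mat, p \in unitmx &
    forall f, is_loop X b f -> rho' f = p *m rho f *m invmx p.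

(* The quotient of irreps by simultaneous conjugation, as the set of the
   equivalence classes. *)
Definition char_variety (t : 'I_3 -> P1 R) (b : P1 R) (C : 'I_3 -> set Mat) :
    set (set ((R -> P1 R) -> Mat)) :=
  [set [set rho' | irreps t b C rho' /\ rep_equiv (punctured t) b rho rho']
     | rho in irreps t b C].

(* C is isomorphic to GL_r / Z(g) for any g in C, and Z(g) is open in the linear
   space of the matrices commuting with g. *)
Definition class_dim (C : set Mat) : int :=
  (r ^ 2)%:Z - (\rank (cent_mx (mxvec (xget 0 C))))%:Z.

(* The dimension of a non-empty character variety is given by
   \sum_i dim C_i - 2 r^2 + 2. *)
Definition char_variety_has_dim (t : 'I_3 -> P1 R) (b : P1 R)
    (C : 'I_3 -> set Mat) (d : int) : Prop :=
  char_variety t b C !=set0 /\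
  d = \sum_(i < 3) class_dim (C i) - 2 * (r ^ 2)%:Z + 2.

Definition jordan_block (a : R[i]) (n : nat) : 'M[R[i]]_n :=
  \matrix_(i, j) (a *+ (i == j) + (i.+1 == j :> nat)%:R).

Definition jordan_mx (n : nat) (a : 'I_n -> R[i]) (m : 'I_n -> nat) :
    'M[R[i]]_(\sum_i m i) :=
  \mxdiag_i jordan_block (a i) (m i).

(* C contains the Jordan matrix with n blocks, the k-th one being of size
   m k > 0 and with eigenvalue a k. *)
Definition jordan_type (C : set Mat) (n : nat) (a : 'I_n -> R[i])
    (m : 'I_n -> nat) : Prop :=
  (forall k, 0 < m k)%N /\
  exists e : (\sum_i m i)%N = r, C (castmx (e, e) (jordan_mx a m)).

Definition num_blocks (n : nat) (a : 'I_n -> R[i]) (m : 'I_n -> nat)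
    (c : R[i]) (j : nat) : nat :=
  #|[set k | (a k == c) && (j <= m k)%N]%SET|.

(* lam is the partition of r associated with C, in decreasing order. Blocks have
   size at most r, so that j need not exceed r. *)
Definition class_partition (C : set Mat) (lam : seq nat) : Prop :=
  exists n (a : 'I_n -> R[i]) (m : 'I_n -> nat), jordan_type C a m /\
    lam = sort geq [seq x <- [seq num_blocks a m c j
                               | c <- undup (codom a), j <- iota 1 r] | (0 < x)%N].

End CharacterVariety.

Definition defect (r : nat) (lam : 'I_3 -> seq nat) : int :=
  r%:Z - \sum_(i < 3) (head 0%N (lam i))%:Z.

Definition MC_minimal (r : nat) (lam : 'I_3 -> seq nat) : Prop :=
  0 <= defect r lam.

(* Main.v *)
Require Import Defs.
From mathcomp Require Import all_boot all_order all_algebra.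
From mathcomp Require Import complex.
From mathcomp Require Import zify.
From mathcomp Require Import all_classical all_reals all_analysis.

Set Implicit Arguments.
Unset Strict Implicit.
Unset Printing Implicit Defensive.

Import Order.TTheory GRing.Theory Num.Theory.

Local Open Scope classical_set_scope.
Local Open Scope ring_scope.
Local Open Scope complex_scope.

(* A class C with partition lambda has a centralizer of dimension
   sum_j (lambda^j)^2, so, with a_i = lambda_i^0 and
   S_i = sum_j lambda_i^j (a_i - lambda_i^j) >= 0,
     d - 2 = r delta + S_1 + S_2 + S_3.
   If delta > 0 then r <= d - 2. If delta = 0 then r = a_1 + a_2 + a_3 and some
   S_i is positive. A part of lambda_i other than a_i contributes at least
   a_i - 1 to S_i, and if a_i divides r the number of such parts is not 1;
   comparing a_1 >= a_2 >= a_3 with r / 2, r / 3 and r / 4 gives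
   r <= 3 (S_1 + S_2 + S_3 + 2). The extremal case is a = (r/2, r/3, r/6). *)

(** * Dimensions of spaces of matrices; centralizers under conjugation *)

Section Rank.
Variables (F : fieldType) (r : nat).
Implicit Types X : 'M[F]_r.

(** Evaluation at the positions in [P] is an isomorphism from [W] onto the functions on [P]: the
    [B p] form a dual family, and an element of [W] that vanishes on [P] is 0. *)
Lemma rank_eval q (W : 'M[F]_(q, r * r)) (P : {set 'I_r * 'I_r})
    (B : 'I_r * 'I_r -> 'M[F]_r) :
  (forall p, p \in P -> (B p \in W)%MS) ->
  {in P &, forall p p', B p p'.1 p'.2 = (p == p')%:R} ->
  (forall X, (X \in W)%MS -> {in P, forall p, X p.1 p.2 = 0} -> X = 0) ->
  \rank W = #|P|.
Proof.
move=> BW BP Winj.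
(* [L] is the matrix of this evaluation map on vectorized matrices. *)
pose L : 'M[F]_(r * r, #|P|) :=
  \matrix_(u, s) (u == mxvec_index (enum_val s).1 (enum_val s).2)%:R.
have LE X : mxvec X *m L = \row_s X (enum_val s).1 (enum_val s).2.
  apply/rowP => s; rewrite !mxE (bigD1 (mxvec_index (enum_val s).1 (enum_val s).2)) //=.
  rewrite mxE eqxx mulr1 mxvecE big1 ?addr0 // => u /negPf nu.
  by rewrite mxE nu mulr0.
pose E := \matrix_(s < #|P|) mxvec (B (enum_val s)).
have EL : E *m L = 1%:M.
  apply/row_matrixP => s; rewrite row_mul rowK LE; apply/rowP => s'.
  by rewrite !mxE BP ?enum_valP // (inj_eq enum_val_inj).
have EW : (E <= W)%MS by apply/row_subP => s; rewrite rowK BW ?enum_valP.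
apply/eqP; rewrite eqn_leq; apply/andP; split; last first.
  have <- : \rank E = #|P| by apply/eqP/row_freeP; exists L.
  exact: mxrankS.
suff /mxrank_injP <- : (W :&: kermx L)%MS == 0 by exact: rank_leq_col.
apply/eqP/row_matrixP => i; rewrite row0.
have : (row i (W :&: kermx L) <= W :&: kermx L)%MS by exact: row_sub.
rewrite sub_capmx => /andP[vW /sub_kermxP].
set v := row i _ in vW *; rewrite -[v]vec_mxK LE => v0.
have -> : vec_mx v = 0; last by rewrite linear0.
apply: Winj; first by rewrite vec_mxK.
move=> p pP; move/rowP/(_ (enum_rank_in pP p)): v0.
by rewrite !mxE enum_rankK_in.
Qed.

Lemma cent_mx1P (A X : 'M[F]_r) :
  reflect (A *m X = X *m A) (X \in cent_mx (mxvec A))%MS.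
Proof.
apply: (iffP cent_rowP) => [/(_ 0)|AX k]; last rewrite [k]ord1.
all: by rewrite row_id mxvecK.
Qed.

(** Conjugation by [p] is an injective linear map, with matrix [M], from one centralizer into the
    other. Applied to [invmx p] as well, this gives equality. *)
Lemma rank_cent_conj_le (A p : 'M[F]_r) : p \in unitmx ->
  (\rank (cent_mx (mxvec A)) <= \rank (cent_mx (mxvec (p *m A *m invmx p))))%N.
Proof.
move=> pu; pose M := lin_mx (mulmx p \o mulmxr (invmx p)).
have Mfree : row_free M.
  apply/row_freeP; exists (lin_mx (mulmx (invmx p) \o mulmxr p)).
  apply/row_matrixP => i; rewrite row_mul rowE -[delta_mx 0 i]vec_mxK.
  rewrite !mul_vec_lin row1; apply: (canLR vec_mxK) => /=.
  by rewrite !mulmxA mulVmx // mul1mx -!mulmxA mulVmx // mulmx1.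
rewrite -(mxrankMfree _ Mfree); apply/mxrankS/row_subP => i.
rewrite row_mul -[row i (cent_mx _)]vec_mxK mul_vec_lin; apply/cent_mx1P => /=.
have : (vec_mx (row i (cent_mx (mxvec A))) \in cent_mx (mxvec A))%MS.
  by rewrite vec_mxK row_sub.
move=> /cent_mx1P; move: (vec_mx _) => X AX.
rewrite !mulmxA !(mulmxKV pu).
by congr (_ *m _); rewrite -!mulmxA AX.
Qed.

Lemma rank_cent_conj (A p : 'M[F]_r) : p \in unitmx ->
  \rank (cent_mx (mxvec (p *m A *m invmx p))) = \rank (cent_mx (mxvec A)).
Proof.
move=> pu; apply/eqP; rewrite eqn_leq rank_cent_conj_le // andbT.
have := @rank_cent_conj_le (p *m A *m invmx p) (invmx p).
rewrite unitmx_inv invmxK !mulmxA mulVmx // mul1mx -!mulmxA mulVmx //.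
by rewrite mulmx1; apply.
Qed.

End Rank.

(** * The centralizer of a Jordan matrix, block by block *)

Section JordanCentralizer.
Variables (F : fieldType) (r n : nat) (a : 'I_n -> F) (m : 'I_n -> nat).
Variables (blk : 'I_r -> 'I_n) (pos : 'I_r -> nat).
Hypothesis pos_lt : forall i, (pos i < m (blk i))%N.
Hypothesis blk_pos_inj : forall i j, blk i = blk j -> pos i = pos j -> i = j.
Hypothesis blk_pos_surj :
  forall k p, (p < m k)%N -> exists i, blk i = k /\ pos i = p.
Implicit Types (X : 'M[F]_r) (i j : 'I_r) (k l : 'I_n) (p q : nat).

(** Indices stay in ['I_r] and are located by [blk] and [pos], which keeps dependent types out of
    the computations with entries. *)
Definition block_jordan : 'M[F]_r := \matrix_(i, j)
  (a (blk i) *+ (i == j) + ((blk i == blk j) && ((pos i).+1 == pos j))%:R).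

(* 0 when there is no row p in block k, or no column q in block l. *)
Definition block_entry X k p l q : F :=
  \sum_(i | (blk i == k) && (pos i == p))
    \sum_(j | (blk j == l) && (pos j == q)) X i j.

Lemma blk_pos_pred1 i :
  (fun j => (blk j == blk i) && (pos j == pos i)) =1 pred1 i.
Proof.
move=> j /=; apply/andP/eqP => [[/eqP e /eqP]|-> //].
exact: blk_pos_inj.
Qed.

Lemma block_entryE X i j : block_entry X (blk i) (pos i) (blk j) (pos j) = X i j.
Proof.
by rewrite /block_entry (big_pred1 i) ?(big_pred1 j) //; apply: blk_pos_pred1.
Qed.

Lemma block_entry_outl X k p l q : (m k <= p)%N -> block_entry X k p l q = 0.
Proof.
move=> mp; rewrite /block_entry big_pred0 // => i; apply/negP.
move=> /andP[/eqP e /eqP e']; have := pos_lt i.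
by rewrite e e' ltnNge mp.
Qed.

Lemma mul_block_jordanl X i j : (block_jordan *m X) i j =
  a (blk i) * X i j + block_entry X (blk i) (pos i).+1 (blk j) (pos j).
Proof.
rewrite mxE; under eq_bigr do rewrite mxE mulrDl.
rewrite big_split /=; congr (_ + _).
  rewrite (bigD1 i) //= eqxx mulr1n big1 ?addr0 // => l /negPf nl.
  by rewrite eq_sym nl mul0r.
rewrite /block_entry [RHS]big_mkcond; apply: eq_bigr => l _.
rewrite (big_pred1 j); last exact: blk_pos_pred1.
by rewrite [blk l == _]eq_sym [pos l == _]eq_sym; case: ifP; rewrite ?mul1r ?mul0r.
Qed.

Lemma mul_block_jordanr X i j : (X *m block_jordan) i j =
  a (blk j) * X i j +
    (if pos j is q.+1 then block_entry X (blk i) (pos i) (blk j) q else 0).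
Proof.
rewrite mxE; under eq_bigr do rewrite mxE mulrDr.
rewrite big_split /=; congr (_ + _).
  rewrite (bigD1 j) //= eqxx mulr1n big1 ?addr0 1?mulrC // => l /negPf nl.
  by rewrite nl mulr0n mulr0.
case e : (pos j) => [|q].
  by rewrite big1 // => l _; rewrite andbF mulr0.
rewrite /block_entry [RHS](big_pred1 i); last exact: blk_pos_pred1.
rewrite [RHS]big_mkcond; apply: eq_bigr => l _.
by rewrite eqSS; case: ifP; rewrite ?mulr1 ?mulr0.
Qed.

(** Commutation splits into one equation N_k Y - Y N_l = (a_l - a_k) Y per pair of blocks, with N_k,
    N_l the nilpotent shifts. The lemmas below solve it. *)
Lemma block_jordan_commP X :
  block_jordan *m X = X *m block_jordan <->
  forall k p l q, (p < m k)%N -> (q < m l)%N ->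
    a k * block_entry X k p l q + block_entry X k p.+1 l q =
    a l * block_entry X k p l q +
      (if q is q'.+1 then block_entry X k p l q' else 0).
Proof.
split=> [JX k p l q /blk_pos_surj[i [<- <-]] /blk_pos_surj[j [<- <-]]|JX].
  by rewrite !block_entryE -mul_block_jordanl JX mul_block_jordanr.
apply/matrixP => i j; rewrite mul_block_jordanl mul_block_jordanr.
by rewrite -[X i j]block_entryE JX.
Qed.

(* An intertwiner between the blocks k and l is constant along diagonals; it is
   determined by its row 0, whose first m l - m k entries vanish. *)
Definition intertwiner_index : {set 'I_r * 'I_r} :=
  [set ij | [&& pos ij.1 == 0%N, a (blk ij.1) == a (blk ij.2)
              & (m (blk ij.2) <= pos ij.2 + m (blk ij.1))%N]].

Definition intertwiner (ij : 'I_r * 'I_r) : 'M[F]_r := \matrix_(i, j)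
  [&& blk i == blk ij.1, blk j == blk ij.2 & pos j == (pos i + pos ij.2)%N]%:R.

Lemma block_entry_outr X k p l q : (m l <= q)%N -> block_entry X k p l q = 0.
Proof.
move=> mq; rewrite /block_entry big1 // => i _; rewrite big_pred0 // => j.
apply/negP => /andP[/eqP e /eqP e']; have := pos_lt j.
by rewrite e e' ltnNge mq.
Qed.

Lemma block_entry_intertwiner ij k p l q :
  block_entry (intertwiner ij) k p l q =
  [&& (p < m k)%N, (q < m l)%N, k == blk ij.1, l == blk ij.2
    & q == (p + pos ij.2)%N]%:R.
Proof.
have [/block_entry_outl -> //|pk] := leqP.
have [/block_entry_outr -> //|ql] := leqP.
have [i [<- <-]] := blk_pos_surj pk; have [j [<- <-]] := blk_pos_surj ql.
by rewrite block_entryE mxE.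
Qed.

Lemma intertwiner_comm ij : ij \in intertwiner_index ->
  block_jordan *m intertwiner ij = intertwiner ij *m block_jordan.
Proof.
rewrite inE => /and3P[_ /eqP eqa mle]; apply/block_jordan_commP => k p l q pk ql.
rewrite !block_entry_intertwiner pk ql /=.
have [nk /=|nk] := eqVneq k (blk ij.1); last first.
  by rewrite !andbF /= !mulr0 !add0r; case: q {ql} => // q;
    rewrite block_entry_intertwiner (negPf nk) !andbF.
have [e /=|nl] := eqVneq l (blk ij.2); last first.
  by rewrite !andbF /= !mulr0 !add0r; case: q {ql} => // q;
    rewrite block_entry_intertwiner (negPf nl) !andbF.
move: pk ql; rewrite nk e -eqa => pk ql; congr (_ + _).
case: q ql => [|q] ql; first by rewrite addSn andbF.
rewrite block_entry_intertwiner pk !eqxx (ltnW ql) /= addSn eqSS.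
congr (_%:R); congr nat_of_bool.
(* It remains to see that [p.+1] is still a row of the block: by the last condition in
   [intertwiner_index], the diagonal does not go past the bottom row before reaching the last
   column. *)
case: eqP => [eq|]; rewrite ?andbF // andbT; apply/idP.
move: eq ql mle; clear -pk; move: (m _) (m _) (pos _) pk => u v w; lia.
Qed.

(** The recurrence expresses (a_k - a_l) Y(p, q) by Y(p + 1, q) and Y(p, q - 1), for both of which q
    + (m_k - p) is smaller. *)
Lemma comm_block_jordan_neq X k l : a k != a l ->
  block_jordan *m X = X *m block_jordan ->
  forall p q, block_entry X k p l q = 0.
Proof.
move=> akl /block_jordan_commP JX.
suff H N p q : (q + (m k - p) <= N)%N -> block_entry X k p l q = 0.
  by move=> p q; apply: H.
elim: N p q => [|N IH] p q le.
  by apply: block_entry_outl; move: le; lia.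
have [/block_entry_outl -> //|pk] := leqP (m k) p.
have [/block_entry_outr -> //|ql] := leqP (m l) q.
have := JX k p l q pk ql; rewrite (IH p.+1 q); last by move: le pk; lia.
have -> : (if q is q'.+1 then block_entry X k p l q' else 0) = 0.
  by case: q le ql => // q le ql; apply: IH; move: le pk; lia.
move=> /eqP; rewrite !addr0 -subr_eq0 -mulrBl mulf_eq0 subr_eq0 (negPf akl).
by move/eqP.
Qed.

(** For equal eigenvalues the recurrence reads Y(p + 1, q) = Y(p, q - 1). The value [p = m k], one
    row below the block, is allowed: there the entry is 0, which forces zeros in row 0. *)
Lemma comm_block_jordan_diag X k l p q : a k = a l ->
  block_jordan *m X = X *m block_jordan -> (p <= m k)%N -> (q < m l)%N ->
  block_entry X k p l q = if (p <= q)%N then block_entry X k 0 l (q - p) else 0.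
Proof.
move=> akl /block_jordan_commP JX; elim: p q => [|p IH] q pk ql.
  by rewrite subn0.
have := JX k p l q pk ql; rewrite akl => /addrI ->.
by case: q ql => // q ql; rewrite IH ?(ltnW ql) ?(ltnW pk).
Qed.

Lemma comm_block_jordan_eq0 X :
  block_jordan *m X = X *m block_jordan ->
  {in intertwiner_index, forall ij, X ij.1 ij.2 = 0} -> X = 0.
Proof.
move=> JX X0; apply/matrixP => i j; rewrite mxE -block_entryE.
have [akl|/comm_block_jordan_neq] := eqVneq (a (blk i)) (a (blk j)); last exact.
have row0 q : (q < m (blk j))%N -> block_entry X (blk i) 0 (blk j) q = 0.
  move=> qj; have [le|lt] := leqP (m (blk j)) (q + m (blk i)).
    have [i' [ei' pi']] := blk_pos_surj (leq_ltn_trans (leq0n _) (pos_lt i)).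
    have [j' [ej' pj']] := blk_pos_surj qj.
    rewrite -ei' -ej' -{1}pi' -{1}pj' block_entryE.
    by rewrite (X0 (i', j')) // inE /= pi' ei' ej' akl pj' le !eqxx.
  (* The diagonal from column [q] of row 0 runs out through the bottom of the block. *)
  have := comm_block_jordan_diag akl JX (leqnn _) lt.
  by rewrite block_entry_outl // leq_addl addnK => <-.
rewrite comm_block_jordan_diag ?(ltnW (pos_lt i)) //.
case: ifP => // _; apply: row0; exact: leq_ltn_trans (leq_subr _ _) (pos_lt j).
Qed.

(** The intertwiners are a basis of the centralizer, dual to the evaluations at
    [intertwiner_index]. *)
Lemma rank_cent_block_jordan :
  \rank (cent_mx (mxvec block_jordan)) = #|intertwiner_index|.
Proof.
apply: (rank_eval (B := intertwiner)) => [p /intertwiner_comm/cent_mx1P //||].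
  move=> p p'; rewrite !inE => /and3P[/eqP p0 _ _] /and3P[/eqP p'0 _ _].
  rewrite mxE p'0 add0n; congr (nat_of_bool _)%:R.
  apply/and3P/eqP => [[/eqP e1 /eqP e2 /eqP e3]|<-]; last by [].
  case: p p' p0 p'0 e1 e2 e3 => [i j] [i' j'] /= p0 p'0 e1 e2 e3.
  by congr (_, _); apply: blk_pos_inj; rewrite ?p0 ?p'0.
by move=> X /cent_mx1P; apply: comm_block_jordan_eq0.
Qed.

End JordanCentralizer.

(** * The centralizer dimension as a sum of squares of block counts *)

Lemma sum_tagnat n (m : 'I_n -> nat) (G : 'I_n -> nat -> nat) :
  (\sum_(i < \sum_k m k) G (tagnat.sig1 i) (tagnat.sig2 i) =
   \sum_k \sum_(p < m k) G k p)%N.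
Proof.
rewrite (reindex (tagnat.rank (p_ := m))) /=; last exact: tagnat.rank_bij_on.
rewrite [RHS](sig_big_dep (I := 'I_n) (J := fun k => 'I_(m k)) xpredT
  (fun _ => xpredT) (fun k (p : 'I_(m k)) => G k p)) /=.
by apply: eq_bigr => u _; rewrite /tagnat.sig1 /tagnat.sig2 tagnat.rankK.
Qed.

Lemma card_set_pair (T1 T2 : finType) (P : T1 -> T2 -> bool) :
  #|[set u : T1 * T2 | P u.1 u.2]%SET| = (\sum_i \sum_j P i j)%N.
Proof.
rewrite (pair_bigA _ (fun i j => P i j : nat)) /= -sum1dep_card big_mkcond.
by apply: eq_bigr => u _; case: (P _ _).
Qed.

Lemma sum_ord_geq b s : (\sum_(q < b) (s <= q) = b - s)%N.
Proof.
elim: b => [|b IH]; first by rewrite big_ord0.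
by rewrite big_ord_recr /= IH; case: leqP; lia.
Qed.

Lemma sum_iota1_leq r s : (s <= r)%N -> (\sum_(j <- iota 1 r) (j <= s) = s)%N.
Proof.
move=> sr; rewrite -[RHS](minn_idPr sr).
have -> : iota 1 r = index_iota 1 r.+1 by rewrite /index_iota subn1.
elim: r {sr} => [|r IH]; first by rewrite big_geq // min0n.
by rewrite big_nat_recr //= IH; case: leqP; lia.
Qed.

Section JordanMx.
Variables (R : realType) (n : nat) (a : 'I_n -> R[i]) (m : 'I_n -> nat).
Let pos (i : 'I_(\sum_k m k)) : nat := tagnat.sig2 i.

Lemma jordan_mxE : jordan_mx a m = block_jordan a (tagnat.sig1 (p_ := m)) pos.
Proof.
apply/matrixP => i j; rewrite !mxE -(inj_eq tagnat.sig_inj) 2!tagnat.sigE12 /pos.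
move: (tagnat.sig1 i) (tagnat.sig2 i) (tagnat.sig1 j) (tagnat.sig2 j).
move=> k p l q.
have [e|nkl] /= := eqVneq k l; last first.
  rewrite mxE addr0; case: eqP => [/(congr1 tag) /= e|]; last by rewrite mulr0n.
  by rewrite e eqxx in nkl.
by case: _ / e q => q; rewrite conform_mx_id mxE eq_Tagged.
Qed.

(** For two blocks with the same eigenvalue, the indices lie in row 0 and in the columns q with m_l
    - m_k <= q < m_l, of which there are min(m_k, m_l). *)
Lemma rank_cent_jordan :
  \rank (cent_mx (mxvec (jordan_mx a m))) =
  (\sum_k \sum_l (a k == a l) * minn (m k) (m l))%N.
Proof.
rewrite jordan_mxE (@rank_cent_block_jordan _ _ _ a m).
- rewrite /intertwiner_index (card_set_pair (fun i j => [&& pos i == 0%N,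
    a (tagnat.sig1 i) == a (tagnat.sig1 j)
    & (m (tagnat.sig1 j) <= pos j + m (tagnat.sig1 i))%N])) /pos.
  rewrite (sum_tagnat _ (fun k p => \sum_j [&& p == 0, a k == a (tagnat.sig1 j)
    & m (tagnat.sig1 j) <= pos j + m k])%N).
  apply: eq_bigr => k _.
  transitivity (\sum_(p < m k) (p == 0 :> nat) *
      \sum_l (a k == a l) * minn (m k) (m l))%N.
    apply: eq_bigr => p _.
    rewrite (sum_tagnat _
      (fun l q => [&& p == 0 :> nat, a k == a l & (m l <= q + m k)]%N)).
    rewrite big_distrr /=; apply: eq_bigr => l _.
    case: eqP => _ /=; last by rewrite mul0n big1.
    rewrite mul1n; case: eqP => _ /=; last by rewrite mul0n big1.
    under eq_bigr do rewrite addnC -leq_subLR.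
    by rewrite mul1n sum_ord_geq; lia.
  (* An empty block has no row 0, but then the minimum is 0 too. *)
  rewrite -big_distrl /=; case: (m k) => [|mk].
    by rewrite big_ord0 big1 // => l _; rewrite min0n muln0.
  by rewrite big_ord_recl big1 ?mul1n.
- by move=> i; exact: ltn_ord.
- move=> u v e1 e2; rewrite -[u]tagnat.sig2K -[v]tagnat.sig2K.
  by apply/val_inj/eqP; rewrite tagnat.eq_Rank; apply/andP; split; apply/eqP.
- move=> k p pk; exists (tagnat.Rank k (Ordinal pk)).
  by split; [exact: tagnat.Rank1K | rewrite /pos tagnat.Rank2K].
Qed.

Lemma sum_undup_codom c : c \in codom a ->
  (\sum_(c' <- undup (codom a)) (c == c') = 1)%N.
Proof.
move=> ca; rewrite (bigD1_seq c) ?mem_undup ?undup_uniq //= eqxx.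
by rewrite big1 // => c' /negPf; rewrite eq_sym => ->.
Qed.

Definition jordan_counts r := [seq num_blocks a m c j
  | c <- undup (codom a), j <- iota 1 r].

Lemma num_blocksE c j : num_blocks a m c j = (\sum_k (a k == c) * (j <= m k))%N.
Proof.
rewrite /num_blocks -sum1dep_card big_mkcond /=; apply: eq_bigr => k _.
by case: (a k == c); case: (j <= m k)%N.
Qed.

(** Block k is counted under its own eigenvalue only, once for each j from 1 to m_k. *)
Lemma sum_jordan_counts r : (forall k, (m k <= r)%N) ->
  (\sum_(x <- jordan_counts r) x = \sum_k m k)%N.
Proof.
move=> mr; rewrite /jordan_counts big_allpairs_dep /=.
under eq_bigr do under eq_bigr do rewrite num_blocksE.
under eq_bigr do rewrite exchange_big /=.
rewrite exchange_big /=; apply: eq_bigr => k _.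
under eq_bigr do rewrite -big_distrr /= sum_iota1_leq //.
by rewrite -big_distrl /= sum_undup_codom ?mul1n // codom_f.
Qed.

(** A squared count is a number of pairs of blocks with sizes >= j and the same eigenvalue; summed
    over j, each such pair (k, l) contributes min(m_k, m_l). *)
Lemma sum_sqr_jordan_counts r : (forall k, (m k <= r)%N) ->
  (\sum_(x <- jordan_counts r) x ^ 2 =
   \sum_k \sum_l (a k == a l) * minn (m k) (m l))%N.
Proof.
move=> mr; rewrite /jordan_counts big_allpairs_dep /=.
transitivity (\sum_(c <- undup (codom a)) \sum_(j <- iota 1 r)
  \sum_k \sum_l (a k == c) * (a l == c) * (j <= minn (m k) (m l)))%N.
  apply: eq_bigr => c _; apply: eq_bigr => j _.
  rewrite num_blocksE -mulnn big_distrl /=; apply: eq_bigr => k _.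
  rewrite big_distrr /=; apply: eq_bigr => l _.
  by rewrite leq_min mulnACA; case: (j <= m k)%N => //=; rewrite ?mul0n ?mul1n.
under eq_bigr do rewrite exchange_big /=.
rewrite exchange_big /=; apply: eq_bigr => k _.
under eq_bigr do rewrite exchange_big /=.
rewrite exchange_big /=; apply: eq_bigr => l _.
under eq_bigr => c _.
  rewrite -big_distrr /= sum_iota1_leq; last by rewrite geq_min mr.
  over.
rewrite -big_distrl /=; congr (_ * _)%N.
have [->|ne] := eqVneq (a k) (a l).
  under eq_bigr do rewrite mulnb andbb.
  by rewrite sum_undup_codom // codom_f.
rewrite big1 // => c _; rewrite mulnb; case: eqP => //= <-.
by rewrite eq_sym (negPf ne).
Qed.

End JordanMx.

(** * The dimension of a conjugacy class from its partition *)

Section ClassPartition.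
Variables (R : realType) (r : nat).
Implicit Types C : set 'M[R[i]]_r.

Lemma conj_orbit_rank_cent (g h h' : 'M[R[i]]_r) :
  conj_orbit g h -> conj_orbit g h' ->
  \rank (cent_mx (mxvec h)) = \rank (cent_mx (mxvec h')).
Proof.
move=> [p pu ->] [q qu ->].
transitivity (\rank (cent_mx (mxvec g))); first exact: rank_cent_conj.
by symmetry; exact: rank_cent_conj.
Qed.

Lemma class_partitionP C lam : conjugacy_class C -> class_partition C lam ->
  [/\ sorted geq lam, all (leq 1) lam, sumn lam = r &
      class_dim C = (r ^ 2)%:Z - (\sum_(x <- lam) x ^ 2)%N%:Z].
Proof.
move=> [g _ Cg] [n [a [m [[_ [e CJ]] ->]]]].
have mr k : (m k <= r)%N by rewrite -e (bigD1 k) //= leq_addr.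
rewrite -/(jordan_counts a m r).
set s := [seq x <- _ | _].
have sumE f : f 0 = 0%N ->
    (\sum_(x <- sort geq s) f x = \sum_(x <- jordan_counts a m r) f x)%N.
  move=> f0; rewrite (perm_big s) /=; last by rewrite perm_sort.
  rewrite big_filter big_mkcond; apply: eq_bigr => x _.
  by case: x => //=; rewrite f0.
split.
- by apply: sort_sorted => x y; exact: leq_total.
- by apply/allP => x; rewrite mem_sort mem_filter => /andP[].
- by rewrite sumnE sumE // sum_jordan_counts.
rewrite sumE // sum_sqr_jordan_counts // -rank_cent_jordan.
congr (_ - Posz _).
have CE h : C h -> conj_orbit g h by rewrite Cg.
(* As [C] contains a Jordan matrix, the representative chosen in [class_dim] is not the default 0 of
   an empty class. *)
have /CE CX : C (xget 0 C) by exact: xgetI CJ.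
move/CE in CJ.
transitivity (\rank (cent_mx (mxvec (castmx (e, e) (jordan_mx a m))))).
  exact: conj_orbit_rank_cent CX CJ.
by case: r / e {mr sumE s CE CX CJ Cg g C} => *; rewrite castmx_id.
Qed.

End ClassPartition.

(** * Arithmetic of the three partitions *)

Section Deviation.
Local Open Scope nat_scope.

(** This is S_i when [a] is the largest part; it measures how far the partition is from having all
    parts equal. *)
Definition deviation (a : nat) (s : seq nat) : nat := \sum_(x <- s) x * (a - x).

(* The cases are: no element of s, exactly one, or at least two differ from a. *)
Definition deviation_spec (a n S : nat) : Prop :=
  [\/ S = 0 /\ exists k, n = k * a,
      exists x k, [/\ 0 < x < a, S = x * (a - x) & n = x + k * a]
    | (a - 1).*2 <= S].

(** The difference of the two sides is (x - 1) (a - x - 1). *)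
Lemma pred_leq_mul_sub a x : 0 < x < a -> a - 1 <= x * (a - x).
Proof. by case/andP; nia. Qed.

Lemma deviationP a s : 0 < a -> all (fun x => 0 < x <= a) s ->
  deviation_spec a (sumn s) (deviation a s).
Proof.
move=> a0; elim: s => [|y s IH] /=.
  by rewrite /deviation big_nil; constructor 1; split => //; exists 0.
case/andP=> /andP[y0]; rewrite /deviation big_cons -/(deviation a s).
rewrite leq_eqVlt => /predU1P[-> /IH {IH}|ya /IH {IH}].
  rewrite subnn muln0 add0n.
  case=> [[-> [k ->]]|[x [k [xa -> ->]]]|]; last by constructor 3.
    by constructor 1; split => //; exists k.+1; rewrite mulSn.
  by constructor 2; exists x, k.+1; split => //; lia.
have yb : a - 1 <= y * (a - y) by apply: pred_leq_mul_sub; rewrite y0.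
case=> [[-> [k ->]]|[x [k [/pred_leq_mul_sub xb -> _]]]|le].
- by constructor 2; exists y, k; rewrite addn0 y0.
- by constructor 3; lia.
- by constructor 3; lia.
Qed.

Lemma deviation_spec_geq a n S : deviation_spec a n S ->
  (S = 0 /\ exists k, n = k * a) \/ a - 1 <= S.
Proof.
case=> [|[x [k [/pred_leq_mul_sub le -> _]]]|le]; [by left|by right|right; lia].
Qed.

(** A single exceptional part would be a nonzero remainder of [n] modulo [a]. *)
Lemma deviation_spec_dvd a n S k : deviation_spec a n S -> n = k * a ->
  S = 0 \/ (a - 1).*2 <= S.
Proof.
case=> [[-> _]|[x [l [/andP[x0 xa] _ ->]]]|]; [by left| |by right].
move=> e; exfalso; have : (x + l * a) %% a = 0 by rewrite e modnMl.
by rewrite addnC modnMDl modn_small //; lia.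
Qed.

Lemma sum3_leq_deviation_sorted r a1 a2 a3 S1 S2 S3 :
  deviation_spec a1 r S1 -> deviation_spec a2 r S2 -> deviation_spec a3 r S3 ->
  0 < a3 -> a3 <= a2 -> a2 <= a1 -> r = a1 + a2 + a3 -> 0 < S1 + S2 + S3 ->
  r <= 3 * (S1 + S2 + S3 + 2).
Proof.
move=> D1 D2 D3 a3_gt0 le32 le21 er S_gt0.
(* If a1 - 1 <= S1, then r <= 3 a1 <= 3 (S1 + 1). Otherwise a1 divides r, and a1 < r <= 3 a1. *)
have [[S1_0 [k1 ek1]]|] := deviation_spec_geq D1; last by lia.
have : k1 = 2 \/ k1 = 3 by case: k1 ek1 => [|[|[|[|k]]]]; rewrite ?mulSn; lia.
case=> ek; rewrite {k1}ek in ek1; last first.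
  have [[S2_0 _]|] := deviation_spec_geq D2; last by lia.
  have [[S3_0 _]|] := deviation_spec_geq D3; lia.
(* Now a1 = r/2, hence r/4 <= a2 < r/2. *)
have ea1 : a1 = a2 + a3 by lia.
case: (D2) => [[S2_0 [k ek]]|[x [k [/andP[x0 xa] eS2 ek]]]|]; last by lia.
  have : k = 3 \/ k = 4.
    by case: k ek => [|[|[|[|[|k]]]]]; rewrite ?mulSn; lia.
  case=> e; rewrite {k}e in ek.
    (* The extremal case: S3 is positive, hence at least 2 (a3 - 1). *)
    have e6 : r = 6 * a3 by lia.
    by have [|] := deviation_spec_dvd D3 e6; lia.
  have e4 : r = 4 * a3 by lia.
  by have [|] := deviation_spec_dvd D3 e4; lia.
have le2 : a2 - 1 <= S2 by rewrite eS2 pred_leq_mul_sub // x0.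
have : k = 2 \/ k = 3 by case: k ek => [|[|[|[|k]]]]; rewrite ?mulSn; lia.
case=> e; rewrite {k}e in ek; first by lia.
(* Here x = 2 a3 - a2 lies strictly between 0 and a2, so 4 a3 < r < 6 a3. If a3 divides r, then r =
   5 a3 = 10 x, and 10 x <= 3 (2 x^2 + 2) always holds. *)
have [[S3_0 [k ek3]]|] := deviation_spec_geq D3; last by lia.
have {}ek3 : r = 5 * a3.
  by case: k ek3 => [|[|[|[|[|[|k]]]]]]; rewrite ?mulSn; lia.
have ea2 : a2 = 3 * x by lia.
have : S2 = 2 * x * x by rewrite eS2 ea2; nia.
nia.
Qed.

Lemma sum3_leq_deviation r a1 a2 a3 S1 S2 S3 :
  deviation_spec a1 r S1 -> deviation_spec a2 r S2 -> deviation_spec a3 r S3 ->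
  0 < a1 -> 0 < a2 -> 0 < a3 -> r = a1 + a2 + a3 -> 0 < S1 + S2 + S3 ->
  r <= 3 * (S1 + S2 + S3 + 2).
Proof.
move=> D1 D2 D3 *; have H := sum3_leq_deviation_sorted.
case: (leqP a1 a2) => ?; case: (leqP a2 a3) => ?; case: (leqP a1 a3) => ?.
all: try lia.
- by have := H _ _ _ _ _ _ _ D3 D2 D1; lia.
- by have := H _ _ _ _ _ _ _ D2 D3 D1; lia.
- by have := H _ _ _ _ _ _ _ D2 D1 D3; lia.
- by have := H _ _ _ _ _ _ _ D3 D1 D2; lia.
- by have := H _ _ _ _ _ _ _ D1 D3 D2; lia.
- by have := H _ _ _ _ _ _ _ D1 D2 D3; lia.
Qed.

Lemma deviationE (a : nat) s : all (fun x => x <= a) s ->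
  deviation a s + \sum_(x <- s) x ^ 2 = a * sumn s.
Proof.
elim: s => [|y s IH] /=; first by rewrite /deviation !big_nil muln0.
case/andP=> ya /IH; rewrite /deviation !big_cons; nia.
Qed.

Lemma sorted_geq_leq_head s : sorted geq s -> all (fun x => x <= head 0 s) s.
Proof.
case: s => //= y s; rewrite leqnn /=; apply: order_path_min => u v w uv vw.
exact: leq_trans vw uv.
Qed.

Lemma deviation_partition s : sorted geq s -> all (leq 1) s -> 0 < sumn s ->
  [/\ 0 < head 0 s, deviation_spec (head 0 s) (sumn s) (deviation (head 0 s) s)
    & deviation (head 0 s) s + \sum_(x <- s) x ^ 2 = head 0 s * sumn s].
Proof.
move=> /sorted_geq_leq_head le pos_s s_gt0.
have a0 : 0 < head 0 s by case: s pos_s s_gt0 {le} => //= y s /andP[].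
split => //; last exact: deviationE.
apply: deviationP => //; rewrite all_predI.
by rewrite [X in X && _]pos_s.
Qed.

End Deviation.

(** * From the dimension formula to the bound on r *)

Theorem theorem2p8 (R : realType) (d r : nat) (t : 'I_3 -> P1 R) (b : P1 R)
    (C : 'I_3 -> set 'M[R[i]]_r) (lam : 'I_3 -> seq nat) :
  (2 < d)%N -> ~~ odd d ->
  injective t -> punctured t b ->
  (forall i, conjugacy_class (C i)) ->
  (forall i, class_partition (C i) (lam i)) ->
  MC_minimal r lam ->
  char_variety_has_dim t b C d%:Z ->
  (r <= 3 * d)%N.
Proof.
move=> d_gt2 _ _ _ Cc Clam; rewrite /MC_minimal /defect => min [_].
have [r0|r_gt0] := posnP r; first by lia.
have P i : [/\ (0 < head 0%N (lam i))%N,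
    deviation_spec (head 0%N (lam i)) r (deviation (head 0%N (lam i)) (lam i)) &
    class_dim (C i) = (r ^ 2)%:Z +
      (deviation (head 0%N (lam i)) (lam i))%:Z - (head 0%N (lam i) * r)%:Z].
  have [srt pos_lam e ->] := class_partitionP (Cc i) (Clam i).
  have [] := deviation_partition srt pos_lam; rewrite e // => a_gt0 D dev.
  by split=> //; rewrite -dev PoszD opprD addrA addrK.
move: min; rewrite !big_ord_recl !big_ord0.
move: (P ord0) (P (lift ord0 ord0)) (P (lift ord0 (lift ord0 ord0))).
move=> [+ + ->] [+ + ->] [+ + ->].
move: (deviation _ _) (deviation _ _) (deviation _ _) => S1 S2 S3.
move: (head _ _) (head _ _) (head _ _) => a1 a2 a3.
move=> a3_gt0 D3 a2_gt0 D2 a1_gt0 D1 min dE.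
have {min}min : (a1 + a2 + a3 <= r)%N by lia.
have {}dE : (d + (a1 + a2 + a3) * r = r * r + S1 + S2 + S3 + 2)%N by lia.
(* A positive defect makes r delta at least r, so that r + 2 <= d. *)
have [lt|ge] := ltnP (a1 + a2 + a3) r; first by nia.
have er : r = (a1 + a2 + a3)%N by lia.
have dS : d = (S1 + S2 + S3 + 2)%N by nia.
(* That some S_i is positive is exactly d > 2. *)
rewrite dS; apply: (sum3_leq_deviation D1 D2 D3) => //; lia.
Qed.
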